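(* Let $X$ be a real Banach space. Then $X$ is of type (DV) if and only if $X$ is reflexive.
   Context: $X$ is a real Banach space with continuous dual $X^*$, bidual $X^{**}$ and third dual $X^{***}$; $X$ is regarded as a subspace of $X^{**}$ and $X^*$ as a subspace of $X^{***}$ via the canonical embeddings, and $\langle\cdot,\cdot\rangle$ denotes the duality pairings. A set-valued operator $A:X\rightrightarrows X^*$ has graph $\operatorname{gra}A=\{(x,x^* )\in X\times X^*\mid x^*\in Ax\}$. $A$ is monotone if $\langle x-y,x^*-y^*\rangle\ge 0$ for all $(x,x^* ),(y,y^* )\in\operatorname{gra}A$, and maximally monotone if it is monotone and has no proper monotone extension in $X\times X^*$ (in the sense of graph inclusion). A maximally monotone operator $A:X\rightrightarrows X^*$ is of type (DV) if for every $(x,x^{***})\in X\times X^{***}$ with $\inf_{(a,a^* )\in\operatorname{gra}A}\langle a-x,a^*-x^{***}\rangle\ge 0$ there exists a bounded net $(a_\alpha,a_\alpha^* )_{\alpha\in\Gamma}$ in $\operatorname{gra}A$ such that $a_\alpha\to x$ in norm and $a_\alpha^*\to x^{***}$ in the weak$^*$ topology $\omega(X^{***},X^{**})$. The Banach space $X$ is of type (DV) if every maximally monotone operator $A:X\rightrightarrows X^*$ is of type (DV). *)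

(* Defs.v *)
From HB Require Import structures.
From mathcomp Require Import all_boot all_order all_algebra.
From mathcomp Require Import all_classical all_reals all_analysis.

Set Implicit Arguments.
Unset Strict Implicit.
Unset Printing Implicit Defensive.

Import Order.TTheory GRing.Theory Num.Theory.
Import numFieldNormedType.Exports.

Local Open Scope classical_set_scope.
Local Open Scope ring_scope.

Section dual.
Context {R : realType} {V : normedModType R}.

Definition cts_linear : {pred V -> R^o} :=
  fun f => `[< linear f /\ continuous f >].

Lemma cts_linear_submod_closed : submod_closed cts_linear.
Proof.
split=> [|a f g /asboolP[lf cf] /asboolP[lg cg]]; apply/asboolP; split.
- by move=> a x y; rewrite scaler0 addr0.
- exact: cst_continuous.
- move=> b x y; rewrite !fctE lf lg !scalerDr !scalerA [b * a]mulrC.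
  by rewrite addrACA.
- move=> x; apply: (@cvgD _ _ _ _ _ (a \*: f) g); last exact: cg.
  by apply: cvgZl_tmp; exact: cf.
Qed.

HB.instance Definition _ := GRing.isSubmodClosed.Build R (V -> R^o) cts_linear
  cts_linear_submod_closed.

End dual.

Record dual {R : realType} (V : normedModType R) : Type := Dual {
  dual_fun :> V -> R^o;
  _ : dual_fun \in cts_linear }.
Arguments dual_fun : simpl never.

Section dual_lmodType.
Context {R : realType} (V : normedModType R).

HB.instance Definition _ := [isSub for @dual_fun R V].
HB.instance Definition _ := [Choice of dual V by <:].
HB.instance Definition _ := [SubChoice_isSubLmodule of dual V by <:].

End dual_lmodType.

Section dual_norm.
Context {R : realType} {V : normedModType R}.
Implicit Types (f g : dual V) (x : V).

Lemma dual_linear f : linear f.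
Proof. by have /asboolP[] := valP f. Qed.

HB.instance Definition _ f :=
  GRing.isLinear.Build R V R^o *:%R (dual_fun f) (dual_linear f).

Lemma dual_continuous f : continuous f.
Proof. by have /asboolP[] := valP f. Qed.

Lemma dualP f g : f =1 g -> f = g.
Proof. by move=> fg; apply/val_inj/funext. Qed.

Lemma dualD f g x : (f + g) x = f x + g x.
Proof. by []. Qed.

Lemma dualZ (a : R) f x : (a *: f) x = a *: f x.
Proof. by []. Qed.

Lemma dualB f g x : (f - g) x = f x - g x.
Proof. by []. Qed.

Definition dual_norm f : R := sup [set `|f x| | x in [set x | `|x| <= 1]].

Let unit_image f := [set `|f x| | x in [set x : V | `|x| <= 1]].

Lemma unit_image_has_sup f : has_sup (unit_image f).
Proof.
split; first by exists `|f 0|; exists 0 => //=; rewrite normr0.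
have /linear_bounded_continuous/bounded_funP/(_ 1)[M fM] := @dual_continuous f.
by exists M => _ [x /= x1 <-]; exact: fM.
Qed.

Lemma ler_dual_norm f x : `|f x| <= dual_norm f * `|x|.
Proof.
have [->|x0] := eqVneq x 0; first by rewrite linear0 !normr0 mulr0.
have nx0 : 0 < `|x| by rewrite normr_gt0.
rewrite -ler_pdivrMr//; apply: ub_le_sup; first by case: (unit_image_has_sup f).
exists (`|x|^-1 *: x) => /=; first by rewrite normfZV.
by rewrite linearZ/= normrM normfV normr_id mulrC.
Qed.

Lemma dual_norm_le f (M : R) :
  (forall x, `|x| <= 1 -> `|f x| <= M) -> dual_norm f <= M.
Proof.
move=> fM; apply: ge_sup; first by case: (unit_image_has_sup f).
by move=> _ [x /= x1 <-]; exact: fM.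
Qed.

Lemma dual_norm_ge0 f : 0 <= dual_norm f.
Proof.
rewrite (@le_trans _ _ `|f 0|)//.
apply: ub_le_sup; first by case: (unit_image_has_sup f).
by exists 0 => //=; rewrite normr0.
Qed.

Lemma ler_dual_normD f g : dual_norm (f + g) <= dual_norm f + dual_norm g.
Proof.
apply: dual_norm_le => x x1; rewrite dualD (le_trans (ler_normD _ _))//.
by rewrite lerD// (le_trans (ler_dual_norm _ _))// ler_piMr// dual_norm_ge0.
Qed.

Lemma dual_normZ (a : R) f : dual_norm (a *: f) = `|a| * dual_norm f.
Proof.
have le b h : dual_norm (b *: h) <= `|b| * dual_norm h.
  apply: dual_norm_le => x x1; rewrite dualZ normrM ler_wpM2l//.
  by rewrite (le_trans (ler_dual_norm _ _))// ler_piMr// dual_norm_ge0.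
have [->|a0] := eqVneq a 0.
  apply/eqP; rewrite normr0 mul0r eq_le dual_norm_ge0 andbT.
  by have := le 0 f; rewrite normr0 mul0r.
apply/eqP; rewrite eq_le le/= -ler_pdivlMl ?normr_gt0// -normfV.
by rewrite (le_trans _ (le _ _))// scalerA mulVf// scale1r.
Qed.

Lemma dual_norm0_eq0 f : dual_norm f = 0 -> f = 0.
Proof.
move=> f0; apply: dualP => x; apply/eqP; rewrite -normr_le0.
by rewrite (le_trans (ler_dual_norm _ _))// f0 mul0r.
Qed.

HB.instance Definition _ := Lmodule_isNormed.Build R (dual V)
  ler_dual_normD dual_normZ dual_norm0_eq0.

End dual_norm.

(* The canonical embedding J : V -> V''; at V := dual X it is the inclusion of
   X' into X'''. *)
Section bidual_embedding.
Context {R : realType} {V : normedModType R}.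

Lemma eval_cts_linear (x : V) : (fun f : dual V => f x) \in cts_linear.
Proof.
apply/asboolP; have lin : linear (fun f : dual V => f x : R^o) by [].
split=> //.
pose ev : {linear dual V -> R^o} :=
  HB.pack (fun f : dual V => f x : R^o) (GRing.isLinear.Build _ _ _ _ _ lin).
apply: (bounded_linear_continuous (f := ev)).
apply/bounded_funP => r; exists (r * `|x|) => f fr.
by rewrite (le_trans (ler_dual_norm f x))// ler_wpM2r.
Qed.

Definition bidual_embed (x : V) : dual (dual V) :=
  Dual (eval_cts_linear x).

Lemma bidual_embedE x f : bidual_embed x f = f x.
Proof. by []. Qed.

Definition reflexive_space := range bidual_embed = [set: dual (dual V)].

End bidual_embedding.
Arguments bidual_embed : simpl never.
Arguments reflexive_space {R} V.

(* dual V with the topology of pointwise convergence on V; at V := dual (dual X)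
   this is the weak* topology of X''' induced by X''. *)
Definition weak_star {R : realType} (V : normedModType R) : topologicalType :=
  initial_topology (fun f : dual V => (f : {ptws V -> R^o})).

Section nets.
Context {I : Type}.
Implicit Type le : I -> I -> Prop.

Definition directed le :=
  [/\ [set: I] !=set0,
      forall i, le i i,
      forall i j k, le i j -> le j k -> le i k &
      forall i j, exists k, le i k /\ le j k].

(* Convergence of a net u : I -> T along le is u @ tails le --> x. *)
Definition tails le : set_system I :=
  filter_from [set: I] (fun i => [set j | le i j]).

End nets.

Section type_DV.
Context {R : realType} {X : completeNormedModType R}.
Implicit Types A B : X -> set (dual X).

Definition gra A : set (X * dual X) := [set p | A p.1 p.2].

Definition monotone_operator A := forall p q,
  gra A p -> gra A q -> 0 <= (p.2 - q.2) (p.1 - q.1).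

Definition maximally_monotone A :=
  monotone_operator A /\
  forall B, monotone_operator B -> gra A `<=` gra B -> gra A = gra B.

Definition type_DV A :=
  forall (x : X) (x3 : dual (dual (dual X))),
    (0 <= ereal_inf
      [set ((bidual_embed p.2 - x3) (bidual_embed (p.1 - x)))%:E
        | p in gra A])%E ->
    exists (I : Type) (le : I -> I -> Prop) (u : I -> X * dual X),
      [/\ directed le,
          forall i, gra A (u i),
          bounded_set (range u),
          (u i).1 @[i --> tails le] --> x &
          (bidual_embed (u i).2 : weak_star (dual (dual X))) @[i --> tails le]
            --> (x3 : weak_star (dual (dual X)))].

End type_DV.

Definition type_DV_space {R : realType} (X : completeNormedModType R) :=
  forall A : X -> set (dual X), maximally_monotone A -> type_DV A.

(* Main.v *)
(** The zero operator [X x {0}] is maximally monotone, and a pair [(x, x3)] is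
    monotonically related to it exactly when [x3] annihilates [X] in [X''].
    Every bounded net in its graph has second component [0], so type (DV) of
    [X] forces the annihilator of [X] in [X'''] to be trivial. As [X] is closed
    in [X''], Hahn-Banach then gives [X = X'']. Conversely, if [X] is reflexive
    then [X' = X'''], and constant nets work by maximality.

    Hahn-Banach is proved through minimal sublinear functionals: by Zorn's
    lemma every sublinear functional dominates a minimal one, and minimal ones
    are linear. *)

From HB Require Import structures.
Require Import Defs.
From mathcomp Require Import all_boot all_order all_algebra.
From mathcomp Require Import all_classical all_reals all_analysis.
From mathcomp Require Import lra.


Set Implicit Arguments.
Unset Strict Implicit.
Unset Printing Implicit Defensive.

Import Order.TTheory GRing.Theory Num.Theory.
Import numFieldNormedType.Exports.

Local Open Scope classical_set_scope.
Local Open Scope ring_scope.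

(** * Sublinear functionals and the Hahn-Banach theorem *)

Section hahn_banach.
Context {R : realType} {V : lmodType R}.
Implicit Types (p q : V -> R) (x y : V).

Definition sublinear p :=
  (forall x y, p (x + y) <= p x + p y) /\
  (forall (t : R) x, 0 <= t -> p (t *: x) <= t * p x).

Lemma sublinear0 p : sublinear p -> p 0 = 0.
Proof.
move=> [pD pZ]; apply/le_anti/andP; split.
  by have := pZ 0 0 (lexx _); rewrite scale0r mul0r.
by have := pD 0 0; rewrite addr0 lerDl.
Qed.

Lemma sublinear_geN p x : sublinear p -> - p (- x) <= p x.
Proof.
move=> sp; have [pD _] := sp.
by have := pD x (- x); rewrite subrr (sublinear0 sp) -lerBlDr sub0r.
Qed.

Lemma sublinearZ p (t : R) x : sublinear p -> 0 <= t -> p (t *: x) = t * p x.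
Proof.
move=> sp; have [_ pZ] := sp; rewrite le_eqVlt => /predU1P[<-|t0].
  by rewrite scale0r mul0r sublinear0.
apply/le_anti; rewrite (pZ _ _ (ltW t0))/= -ler_pdivlMl//.
have := pZ t^-1 (t *: x); rewrite scalerA mulVf ?gt_eqF// scale1r; apply.
by rewrite invr_ge0 ltW.
Qed.

(** Take for [q x] the infimum of [p (x + t *: x0) - t * p x0] over [t >= 0]. The value [t = 0]
    gives [q <= p], and [t = 1] gives the bound at [- x0]. *)
Lemma sublinear_tilt p x0 : sublinear p ->
  exists q, [/\ sublinear q, forall x, q x <= p x & q (- x0) <= - p x0].
Proof.
move=> sp; have [pD pZ] := sp.
pose S x := [set p (x + t *: x0) - t * p x0 | t in [set t : R | 0 <= t]].
have S0 x : S x !=set0 by exists (p (x + 0 *: x0) - 0 * p x0); exists 0 => /=.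
have Slb x : has_lbound (S x).
  (* Subadditivity applied to [t *: x0 = (x + t *: x0) - x]. *)
  exists (- p (- x)) => _ [t /= t0 <-].
  have := pD (x + t *: x0) (- x).
  rewrite addrAC subrr add0r sublinearZ//; lra.
have Sle x t : 0 <= t -> inf (S x) <= p (x + t *: x0) - t * p x0.
  by move=> t0; apply: ge_inf => //; exists t.
exists (fun x => inf (S x)); split.
- split=> [x y|c x c0].
    rewrite -lerBlDr; apply: lb_le_inf => // _ [t /= t0 <-].
    rewrite lerBlDr -lerBlDl; apply: lb_le_inf => // _ [s /= s0 <-].
    have := Sle (x + y) (t + s) (addr_ge0 t0 s0).
    have := pD (x + t *: x0) (y + s *: x0).
    rewrite scalerDl addrACA mulrDl; lra.
  have [->|cN0] := eqVneq c 0.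
    by have := Sle (0 *: x) 0 (lexx _); rewrite !scale0r addr0 !mul0r
      subr0 (sublinear0 sp).
  have cp : 0 < c by rewrite lt_def cN0.
  rewrite -ler_pdivrMl//; apply: lb_le_inf => // _ [t /= t0 <-].
  rewrite ler_pdivrMl//; apply: le_trans (Sle _ _ (mulr_ge0 c0 t0)) _.
  rewrite -scalerA -scalerDr mulrBr mulrA lerD2r; exact: pZ.
- by move=> x; have := Sle x 0 (lexx _); rewrite scale0r mul0r addr0 subr0.
- have := Sle (- x0) 1 ler01.
  by rewrite scale1r mul1r addNr (sublinear0 sp) sub0r.
Qed.

(** Zorn's lemma for the reversed pointwise order on the sublinear functionals below [p]: a chain is
    bounded by its pointwise infimum, which is finite because all members lie above [- p (- x)]. *)
Lemma sublinear_minimal p : sublinear p ->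
  exists q, [/\ sublinear q, forall x, q x <= p x &
    forall r, sublinear r -> (forall x, r x <= q x) -> r = q].
Proof.
move=> sp.
pose T := {q | sublinear q /\ forall x, q x <= p x}.
pose le (q r : T) := `[< forall x, sval r x <= sval q x >].
pose p0 : T := exist _ p (conj sp (fun=> lexx _)).
have Tlb (q : T) x : - p (- x) <= sval q x.
  case: q => q [sq qp] /=; apply: le_trans (sublinear_geN x sq).
  by rewrite lerN2.
have [| | |F Ftot|[q [sq qp]] qmin] := @Zorn T le.
- by move=> q; apply/asboolP.
- move=> r s t /asboolP rs /asboolP st; apply/asboolP => x.
  exact: le_trans (st x) (rs x).
- move=> [s Ps] [t Pt] /asboolP st /asboolP ts.
  apply: eq_exist; apply/funext => x.
  by apply/le_anti; rewrite st ts.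
(* Adjoining [p0] keeps the infimum meaningful for the empty chain. *)
- pose S x := [set sval q x | q in F `|` [set p0]].
  have S0 x : S x !=set0 by exists (p x), p0 => //; right.
  have Slb x : has_lbound (S x) by exists (- p (- x)) => _ [q _ <-]; exact: Tlb.
  have Sle (q : T) x : (F `|` [set p0]) q -> inf (S x) <= sval q x.
    by move=> Fq; apply: ge_inf => //; exists q.
  (* One member below both [q] and [r] is what makes the infimum subadditive. *)
  have tot (q r : T) : (F `|` [set p0]) q -> (F `|` [set p0]) r ->
      exists s, [/\ (F `|` [set p0]) s, forall x, sval s x <= sval q x &
        forall x, sval s x <= sval r x].
    move=> [Fq|->] [Fr|->].
    - have [/asboolP qr|/asboolP rq] := Ftot _ _ Fq Fr.
        by exists r; split=> //; left.
      by exists q; split=> //; left.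
    - by exists q; split=> //; [left|case: (svalP q)].
    - by exists r; split=> //; [left|case: (svalP r)].
    - by exists p0; split=> //; right.
  have sS : sublinear (fun x => inf (S x)).
    split=> [x y|c x c0].
      rewrite -lerBlDr; apply: lb_le_inf => // _ [q Fq <-].
      rewrite lerBlDr -lerBlDl; apply: lb_le_inf => // _ [r Fr <-].
      have [s [Fs sq sr]] := tot _ _ Fq Fr.
      have [[sD _] _] := svalP s.
      have := Sle s (x + y) Fs; have := sD x y; have := sq x; have := sr y.
      lra.
    have [->|cN0] := eqVneq c 0.
      have := Sle p0 (0 *: x) (or_intror erefl).
      by rewrite scale0r mul0r /= (sublinear0 sp).
    have cp : 0 < c by rewrite lt_def cN0.
    rewrite -ler_pdivrMl//; apply: lb_le_inf => // _ [q Fq <-].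
    rewrite ler_pdivrMl//; apply: le_trans (Sle _ _ Fq) _.
    by have [[_ qZ] _] := svalP q; exact: qZ.
  have Sp : sublinear (fun x => inf (S x)) /\ forall x, inf (S x) <= p x.
    by split=> // x; apply: (Sle p0); right.
  exists (exist _ _ Sp : T).
  by move=> q Fq; apply/asboolP => x /=; apply: Sle; left.
- exists q; split=> // r sr rq.
  have rp x : r x <= p x by exact: le_trans (rq x) (qp x).
  by have [] := qmin (exist _ r (conj sr rp)) (asboolT rq).
Qed.

(* Tilting a minimal functional leaves it unchanged, which makes it odd. *)
Theorem hahn_banach p x0 : sublinear p ->
  exists f : V -> R^o, [/\ linear f, forall x, f x <= p x & f x0 = p x0].
Proof.
(* Tilting before minimizing forces [q (- x0) <= - p x0]; once [q] is odd, this yields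
   [q x0 = p x0]. *)
move=> /(sublinear_tilt x0)[p' [sp' p'p p'x0]].
have [q [sq qp' qmin]] := sublinear_minimal sp'.
have [qD qZ] := sq.
have qN x : q (- x) = - q x.
  apply/le_anti/andP; split; last by rewrite lerNl sublinear_geN.
  have [r [sr rq rx]] := sublinear_tilt x sq.
  by rewrite -{1}(qmin r sr rq).
have qDE x y : q (x + y) = q x + q y.
  apply/le_anti; rewrite qD /=.
  by have := qD (- x) (- y); rewrite -opprD !qN; lra.
exists q; split.
- move=> c x y; rewrite qDE; congr (_ + _).
  have [c0|c0] := leP 0 c; first exact: sublinearZ.
  rewrite -[c]opprK scaleNr qN sublinearZ ?oppr_ge0 1?ltW//.
  by rewrite scaleNr.
- by move=> x; exact: le_trans (qp' x) (p'p x).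
- apply/le_anti/andP; split; first exact: le_trans (qp' _) (p'p _).
  by have := le_trans (qp' (- x0)) p'x0; rewrite qN lerN2.
Qed.

End hahn_banach.

(** * Continuous functionals on normed spaces and the isometry into the bidual *)

Section normed_hahn_banach.
Context {R : realType} {V : normedModType R}.

(** The bound at [- x] makes the estimate two-sided, so [f] is bounded and hence continuous. *)
Lemma dominated_dual (f : V -> R^o) :
  linear f -> (forall x, f x <= `|x|) ->
  exists2 g : dual V, g =1 f & `|g| <= 1.
Proof.
move=> lf f1.
pose l : {linear V -> R^o} := HB.pack f (GRing.isLinear.Build _ _ _ _ _ lf).
have lN x : f (- x) = - f x := linearN l x.
have normf x : `|f x| <= `|x|.
  by rewrite ler_norml f1 lerNl -lN -normrN f1.
have fdual : f \in cts_linear.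
  apply/asboolP; split=> //.
  apply: (bounded_linear_continuous (f := l)).
  by apply/bounded_funP => r; exists r => x; exact: le_trans (normf x).
exists (Dual fdual) => //; apply: dual_norm_le => x x1.
exact: le_trans (normf x) x1.
Qed.

Lemma norming_functional (x : V) :
  exists2 f : dual V, f x = `|x| & `|f| <= 1.
Proof.
have [|f [lf f1 fx]] := @hahn_banach R V (fun x => `|x|) x.
  split=> [y z|c y c0]; first exact: ler_normD.
  by rewrite normrZ ger0_norm.
have [g gf g1] := dominated_dual lf f1.
by exists g; rewrite // gf.
Qed.

(** Hahn-Banach is applied to the distance to the range of [g], a sublinear functional that is at
    most 0 on this range and at least [e] at [x0]. *)
Lemma annihilating_functional (W : lmodType R) (g : {linear W -> V}) (x0 : V) :
  (exists2 e : R, 0 < e & forall w, e <= `|x0 - g w|) ->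
  exists2 f : dual V, (forall w, f (g w) = 0) & f x0 != 0.
Proof.
move=> [e e0 ex0].
pose S x := [set `|x - g w| | w in [set: W]].
have S0 x : S x !=set0 by exists `|x - g 0|, 0.
have Slb x : has_lbound (S x) by exists 0 => _ [w _ <-].
have Sle x w : inf (S x) <= `|x - g w| by apply: ge_inf => //; exists w.
have sS : sublinear (fun x => inf (S x)).
  split=> [x y|c x c0].
    rewrite -lerBlDr; apply: lb_le_inf => // _ [w _ <-].
    rewrite lerBlDr -lerBlDl; apply: lb_le_inf => // _ [v _ <-].
    have := Sle (x + y) (w + v); have := ler_normD (x - g w) (y - g v).
    rewrite addrACA -opprD -linearD; lra.
  have [->|cN0] := eqVneq c 0.
    by have := Sle (0 *: x) 0; rewrite scale0r mul0r linear0 subr0 normr0.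
  have cp : 0 < c by rewrite lt_def cN0.
  rewrite -ler_pdivrMl//; apply: lb_le_inf => // _ [w _ <-].
  rewrite ler_pdivrMl//; apply: le_trans (Sle _ (c *: w)) _.
  by rewrite linearZ -scalerBr normrZ ger0_norm.
have [f [lf fS fx0]] := hahn_banach x0 sS.
have f1 x : f x <= `|x|.
  by apply: le_trans (fS x) _; have := Sle x 0; rewrite linear0 subr0.
have [h hf _] := dominated_dual lf f1; exists h.
  have hg w : h (g w) <= 0.
    rewrite hf; apply: le_trans (fS _) _.
    by have := Sle (g w) w; rewrite subrr normr0.
  move=> w; apply/le_anti; rewrite hg /=.
  by have := hg (- w); rewrite !linearN oppr_le0.
rewrite hf fx0 gt_eqF//; apply: lt_le_trans e0 _.
by apply: lb_le_inf => // _ [w _ <-].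
Qed.

Lemma bidual_embed_linear : linear (@bidual_embed R V).
Proof. by move=> c x y; apply: dualP => f; rewrite bidual_embedE linearP. Qed.

HB.instance Definition _ := GRing.isLinear.Build R V (dual (dual V)) *:%R
  (@bidual_embed R V) bidual_embed_linear.

Lemma norm_bidual_embed (x : V) : `|bidual_embed x| = `|x|.
Proof.
apply/le_anti/andP; split.
  apply: dual_norm_le => f f1; rewrite bidual_embedE.
  by apply: le_trans (ler_dual_norm f x) _; rewrite ler_piMl.
(* A norming functional tests [bidual_embed x] from below. *)
have [f fx f1] := norming_functional x.
have := ler_dual_norm (bidual_embed x) f.
rewrite bidual_embedE fx normr_id => /le_trans; apply.
by rewrite ler_piMr ?dual_norm_ge0.
Qed.

End normed_hahn_banach.

(** * Closedness of [X] in its bidual, and its annihilator *)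

Lemma bidual_embed_closed (R : realType) (X : completeNormedModType R)
    (z : dual (dual X)) :
  (forall e : R, 0 < e -> exists x : X, `|z - bidual_embed x| < e) ->
  range bidual_embed z.
Proof.
move=> zJ.
pose B (e : R) := [set x : X | `|z - bidual_embed x| < e].
(* The points of [X] approximating [z] generate a filter; it is Cauchy by the isometry, and its
   limit in the complete space [X] is mapped to [z]. *)
pose F := filter_from [set e : R | 0 < e] B.
have FF : ProperFilter F.
  apply: filter_from_proper; last by move=> e /zJ[x]; exists x.
  apply: filter_from_filter; first by exists 1 => /=.
  move=> e d e0 d0; exists (Num.min e d); first by rewrite /= lt_min e0.
  by move=> x; rewrite /B /= lt_min => /andP[].
have Fc : cauchy F.
  apply: cauchy_exP => e e0; have e20 : 0 < e / 2 by rewrite divr_gt0.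
  have [x xe] := zJ _ e20; exists x, (e / 2) => // y ye.
  rewrite -ball_normE /ball_ /= [ltRHS]splitr.
  rewrite -norm_bidual_embed linearB -(subrKA z).
  apply: le_lt_trans (ler_normD _ _) _.
  by rewrite ltrD// distrC.
have /cauchy_cvg/cvg_ex[x Fx] := Fc.
exists x => //; apply/eqP; rewrite -subr_eq0 -normr_le0.
apply/ler_addgt0Pl => e e0; rewrite addr0.
have e20 : 0 < e / 2 by rewrite divr_gt0.
have xF : F (ball x (e / 2)) by apply: Fx; exact: nbhsx_ballx.
have zF : F (B (e / 2)) by exists (e / 2).
have [y []] := filter_ex (filterI xF zF).
rewrite -ball_normE /ball_ /B /= => xy zy.
rewrite -(subrKA (bidual_embed y)) [leRHS]splitr.
apply: le_trans (ler_normD _ _) _; apply: lerD.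
  by rewrite -linearB norm_bidual_embed ltW.
by rewrite distrC ltW.
Qed.

Lemma annihilator_nontrivial (R : realType) (X : completeNormedModType R) :
  ~ reflexive_space X ->
  exists (phi : dual (dual (dual X))) (z : dual (dual X)),
    (forall x : X, phi (bidual_embed x) = 0) /\ phi z != 0.
Proof.
move=> Xnr.
have [z zN] : exists z : dual (dual X), ~ range bidual_embed z.
  by apply/existsNP => XJ; apply: Xnr; apply/seteqP; split.
(* By closedness, a point outside the range has positive distance to it. *)
have [e e0 ze] : exists2 e : R,
    0 < e & forall x : X, e <= `|z - bidual_embed x|.
  apply: contrapT => N; apply: zN; apply: bidual_embed_closed => e e0.
  apply: contrapT => Ne; apply: N; exists e => // x.
  by rewrite leNgt; apply/negP => xe; apply: Ne; exists x.
have [phi phiJ phiz] := @annihilating_functional _ _ _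
  (@bidual_embed R X : {linear X -> dual (dual X)}) z (ex_intro2 _ _ e e0 ze).
by exists phi, z.
Qed.

(** * The zero operator, weak* neighbourhoods and the equivalence *)

Lemma zero_operator_maximal (R : realType) (X : completeNormedModType R) :
  maximally_monotone (fun _ : X => [set 0 : dual X]).
Proof.
split=> [p q|B Bm sB].
  by rewrite /gra /= => -> ->; rewrite subrr.
apply/seteqP; split=> // -[y f] Bf; rewrite /gra /=.
apply: dualP => x.
(* Comparing [(y, f)] with the graph point [(y - v, 0)] leaves exactly [f v]. *)
have le0 v : 0 <= f v.
  have := Bm (y, f) (y - v, 0) Bf (sB (y - v, 0) erefl).
  by rewrite /= subr0 opprB addrC subrK.
by apply/le_anti; rewrite le0 andbT -oppr_ge0 -linearN le0.
Qed.

Lemma weak_star_eval_nbhs (R : realType) (V : normedModType R)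
    (phi : dual V) (v : V) (e : R) : 0 < e ->
  nbhs (phi : weak_star V)
    [set psi : weak_star V | `|phi v - (psi : dual V) v| < e].
Proof.
move=> e0.
have c : continuous (fun psi : weak_star V => (psi : dual V) v : R^o).
  move=> psi; apply: (@continuous_comp (weak_star V) {ptws V -> R^o} R^o
    (fun f : dual V => (f : {ptws V -> R^o})) (fun g => g v)).
    exact: initial_continuous.
  exact: proj_continuous.
have /= := c phi [set r | `|phi v - r| < e]; apply.
by have := nbhsx_ballx (phi v : R^o) e e0; rewrite -ball_normE.
Qed.

(** The functional [f] is the restriction of [x3] to [X]; both agree on all of [X''] because every
    element comes from [X]. *)
Lemma bidual_embed_dual_surj (R : realType) (X : completeNormedModType R) :
  reflexive_space X ->
  forall x3 : dual (dual (dual X)), exists f : dual X, bidual_embed f = x3.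
Proof.
move=> Xr x3.
have J3 : (fun x : X => x3 (bidual_embed x) : R^o) \in cts_linear.
  apply/asboolP; have lJ3 : linear (fun x : X => x3 (bidual_embed x) : R^o).
    by move=> c y z; rewrite !linearP.
  split=> //; pose l : {linear X -> R^o} := HB.pack
    (fun x : X => x3 (bidual_embed x) : R^o)
    (GRing.isLinear.Build _ _ _ _ _ lJ3).
  apply: (bounded_linear_continuous (f := l)); apply/bounded_funP => r.
  exists (`|x3| * r) => y yr; apply: le_trans (ler_dual_norm _ _) _.
  by rewrite norm_bidual_embed ler_wpM2l// dual_norm_ge0.
exists (Dual J3); apply: dualP => z.
have [y _ <-] : range bidual_embed z by rewrite Xr.
by [].
Qed.

Theorem theorem3p22 (R : realType) (X : completeNormedModType R) :
  type_DV_space X <-> reflexive_space X.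
Proof.
split=> [DV|Xr A [Am Amax] x x3].
  apply: contrapT => /annihilator_nontrivial[phi [z [phiJ phiz]]].
  (* At the pair [(0, phi)] every pairing in the infimum is 0, since [phi] kills [X]. *)
  have [|I [le [u [[[i0 _] lexx _ _] uA _ _ /=]]]] :=
      DV _ (@zero_operator_maximal R X) 0 phi.
    apply: le_ereal_inf_tmp => _ [p pA <-].
    have -> : p.2 = 0 by exact: pA.
    by rewrite dualB phiJ subr0 bidual_embedE.
  have z0 : 0 < `|phi z| by rewrite normr_gt0.
  (* The radius [|phi z|] excludes the zero functional, yet the net is constantly zero in its second
     component. *)
  move=> /(_ _ (weak_star_eval_nbhs phi z z0))[i _ /(_ i (lexx i))] /=.
  have -> : (u i).2 = 0 by exact: uA.
  by rewrite linear0 subr0 ltxx.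
have [f <-{x3}] := bidual_embed_dual_surj Xr x3.
move=> xf.
have rel p : gra A p -> 0 <= (p.2 - f) (p.1 - x).
  by move=> Ap; rewrite -lee_fin; apply: le_trans xf _; apply: ereal_inf_lbound;
    exists p.
(* Adjoining [(x, f)] preserves monotonicity, so maximality puts this point in the graph of [A]. *)
pose B y : set (dual X) := A y `|` [set g | y = x /\ g = f].
have Bm : monotone_operator B.
  move=> [p1 p2] [q1 q2] [Ap|/= [-> ->]] [Aq|/= [-> ->]].
  - exact: Am (p1, p2) (q1, q2) Ap Aq.
  - exact: rel (p1, p2) Ap.
  - have := rel (q1, q2) Aq.
    by rewrite /= -[x - q1]opprB linearN /= !dualB opprB.
  - by rewrite /= !subrr.
have Axf : gra A (x, f).
  by rewrite (Amax B Bm) => [|p Ap]; [right|left].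
exists unit, (fun _ _ => True), (fun=> (x, f)); split=> //=.
- by split=> //; exists tt.
- exists `|(x, f)|; split; first exact: num_real.
  by move=> M /ltW xM _ [_ _ <-].
- by move=> N /nbhs_singleton Nx; exists tt.
- by move=> N /nbhs_singleton Nf; exists tt.
Qed.
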